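(* Let $m\ge n$, let $D,T\in\mathbb{R}^{m\times n}$ with $\operatorname{rank}(D)=n$, and put $A=D^TD$, $B=T^TT$. Let $A=US^2U^T$ be the spectral decomposition of $A$. Define $\tilde{Q}=SU^TBUS$ and let $\tilde{Q}=\bar{U}\bar{S}^2\bar{U}^T$ be its spectral decomposition. Then the unique minimizer of $\operatorname{tr}(AX+X^{-1}B)$ over all symmetric positive definite matrices $X\in\mathbb{R}^{n\times n}$ is $$X^{\ast}=US^{-1}\bar{U}\bar{S}\bar{U}^TS^{-1}U^T.$$
   Context: For a symmetric matrix $M\in\mathbb{R}^{n\times n}$ with nonnegative eigenvalues, the spectral decomposition means a factorization $M=WK^2W^T$ with $W\in\mathbb{R}^{n\times n}$ orthogonal ($W^TW=WW^T=I$), whose columns are eigenvectors of $M$, and $K$ diagonal, with diagonal entries the nonnegative square roots of the eigenvalues of $M$.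
   Formalization: That X* is a minimizer is proved under the added condition rank(T)=n, without which the claim fails (m=n=1, D=1, T=0: X*=0 is not positive definite and no minimizer exists); that any minimizer equals X* is proved for every T. *)

(* Defs.v *)
From mathcomp Require Import all_boot all_order all_algebra.
From mathcomp Require Import reals.
Set Implicit Arguments.
Unset Strict Implicit.
Unset Printing Implicit Defensive.
Import Order.TTheory GRing.Theory Num.Theory.
Local Open Scope ring_scope.

Definition sym_posdef (R : realType) (n : nat) (X : 'M[R]_n) : Prop :=
  X^T = X /\ forall v : 'cV[R]_n, v != 0 -> 0 < (v^T *m X *m v) 0 0.

Definition orthogonal_mx (R : realType) (n : nat) (W : 'M[R]_n) : Prop :=
  W^T *m W = 1%:M /\ W *m W^T = 1%:M.

(* [K i i] is the nonnegative square root of the eigenvalue of [M] attached to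
   the eigenvector [col i W], which is nonzero because [W] is orthogonal.  No
   ordering of the eigenvalues is imposed. *)
Definition spectral_decomposition (R : realType) (n : nat)
    (M W K : 'M[R]_n) : Prop :=
  [/\ M = W *m K ^+ 2 *m W^T,
      orthogonal_mx W,
      forall i, M *m col i W = (K i i) ^+ 2 *: col i W,
      is_diag_mx K
    & forall i, 0 <= K i i].

Definition minimizer (R : realType) (E : Type) (P : E -> Prop) (f : E -> R)
    (x : E) : Prop :=
  P x /\ forall y, P y -> f x <= f y.

(* Main.v *)
(* Put V = U S^-1 Ubar and s = Sbar.  Then V^T A V = 1, B = V s^2 V^T and
   Xstar = V s V^T.  For X positive definite, completing the square gives
   tr(A X + X^-1 B) = 2 tr s + tr(Z^T X Z) with Z = V^-T - X^-1 V s, and the last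
   term is nonnegative and vanishes only for X = V s V^T.  If T has full rank,
   Xstar is positive definite and attains 2 tr s.  In general the positive
   definite matrices V (s + e) V^T with e > 0 have value at most 2 tr s + n e, so
   2 tr s is the infimum and any minimizer must be Xstar. *)
Require Import Defs.
From mathcomp Require Import all_boot all_order all_algebra.
From mathcomp Require Import reals ring.
Set Implicit Arguments.
Unset Strict Implicit.
Unset Printing Implicit Defensive.
Import Order.TTheory GRing.Theory Num.Theory.
Local Open Scope ring_scope.

Lemma unitmx_ker0 (F : fieldType) (n : nat) (M : 'M[F]_n) :
  (forall v : 'cV[F]_n, M *m v = 0 -> v = 0) -> M \in unitmx.
Proof.
move=> kerM0; rewrite -unitmx_tr -row_free_unit -kermx_eq0.
apply/eqP/row_matrixP => i; rewrite row0 -[LHS]trmxK.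
rewrite (kerM0 (row i (kermx M^T))^T) ?trmx0 //.
by rewrite -{1}[M]trmxK -trmx_mul -row_mul mulmx_ker row0 trmx0.
Qed.

Lemma mulmx_tr_self_eq0 (R : realDomainType) (m : nat) (w : 'cV[R]_m) :
  (w^T *m w) 0 0 = 0 -> w = 0.
Proof.
rewrite mxE => /eqP; rewrite psumr_eq0; last first.
  by move=> i _; rewrite mxE -expr2 sqr_ge0.
move=> /allP w0; apply/colP => i; rewrite mxE.
by have := w0 i (mem_index_enum _); rewrite mxE mulf_eq0 orbb => /eqP.
Qed.

(** If [D^T *m D *m v = 0], then [v^T *m D^T *m D *m v], the squared norm of [D *m v], vanishes, and
    full column rank gives [v = 0]. *)
Lemma unitmx_gram (R : realFieldType) (m n : nat) (D : 'M[R]_(m, n)) :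
  \rank D = n -> D^T *m D \in unitmx.
Proof.
move=> rkD; apply: unitmx_ker0 => v Dv0.
have Dv : D *m v = 0.
  apply: mulmx_tr_self_eq0.
  by rewrite trmx_mul -mulmxA (mulmxA _ D) Dv0 mulmx0 mxE.
have fullD : row_full D by rewrite /row_full rkD.
by apply: (row_full_inj fullD); rewrite Dv mulmx0.
Qed.

Lemma sym_posdef_unitmx (R : realType) (n : nat) (X : 'M[R]_n) :
  sym_posdef X -> X \in unitmx.
Proof.
case=> _ posX; apply: unitmx_ker0 => v Xv0; apply/eqP/negPn/negP => /posX.
by rewrite -mulmxA Xv0 mulmx0 mxE ltxx.
Qed.

Lemma mxquad_diag (R : comPzRingType) (n p : nat) (X : 'M[R]_n)
    (Z : 'M[R]_(n, p)) i :
  (Z^T *m X *m Z) i i = ((col i Z)^T *m X *m col i Z) 0 0.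
Proof.
by rewrite tr_col -!row_mul !mxE; apply: eq_bigr => j _; rewrite !mxE.
Qed.

Lemma mxquad_ge0 (R : realType) (n p : nat) (X : 'M[R]_n) (Z : 'M[R]_(n, p)) i :
  sym_posdef X -> 0 <= (Z^T *m X *m Z) i i.
Proof.
case=> _ posX; rewrite mxquad_diag.
have [->|/posX/ltW//] := eqVneq (col i Z) 0.
by rewrite mulmx0 mxE.
Qed.

Lemma mxtrace_quad_ge0 (R : realType) (n p : nat) (X : 'M[R]_n)
    (Z : 'M[R]_(n, p)) :
  sym_posdef X -> 0 <= \tr (Z^T *m X *m Z).
Proof. by move=> posX; apply: sumr_ge0 => i _; apply: mxquad_ge0. Qed.

(** The trace adds up the quadratic form of [X] at the columns of [Z]. The terms are nonnegative, so
    each vanishes, and definiteness kills every column. *)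
Lemma mxtrace_quad_eq0 (R : realType) (n p : nat) (X : 'M[R]_n)
    (Z : 'M[R]_(n, p)) :
  sym_posdef X -> \tr (Z^T *m X *m Z) = 0 -> Z = 0.
Proof.
move=> posX /eqP; rewrite psumr_eq0; last by move=> i _; apply: mxquad_ge0.
move=> /allP Z0; apply/matrixP => j i.
suff /colP/(_ j) : col i Z = 0 by rewrite !mxE.
apply/eqP/negPn/negP => /(proj2 posX).
have := Z0 i (mem_index_enum _); rewrite mxquad_diag => /eqP ->.
by rewrite ltxx.
Qed.

Section CompletedSquare.

Variables (R : realType) (n : nat) (V W : 'M[R]_n) (s : 'rV[R]_n).
Hypothesis WV : W *m V = 1%:M.

Let A : 'M[R]_n := W^T *m W.
Let B : 'M[R]_n := V *m diag_mx s *m diag_mx s *m V^T.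
Let f (X : 'M[R]_n) : R := \tr (A *m X + invmx X *m B).

Let VW : V *m W = 1%:M. Proof. exact: mulmx1C WV. Qed.
Let VtWt : V^T *m W^T = 1%:M. Proof. by rewrite -trmx_mul WV trmx1. Qed.
Let WtVt : W^T *m V^T = 1%:M. Proof. by rewrite -trmx_mul VW trmx1. Qed.

(** Since [W *m V = 1%:M], both cross terms of [Z^T *m X *m Z] collapse to [diag_mx s]. By cyclicity
    of the trace, the two outer terms give the two summands of [f X]. *)
Lemma objective_square (X : 'M[R]_n) : sym_posdef X ->
  let Z := W^T - invmx X *m V *m diag_mx s in
  f X = (\tr (diag_mx s)) *+ 2 + \tr (Z^T *m X *m Z).
Proof.
move=> posX Z; have uX := sym_posdef_unitmx posX.
have symX : (invmx X)^T = invmx X by rewrite trmx_inv (proj1 posX).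
have Zt : Z^T = W - diag_mx s *m V^T *m invmx X.
  by rewrite linearB /= !trmx_mul trmxK symX tr_diag_mx mulmxA.
have -> : Z^T *m X *m Z = W *m X *m W^T - diag_mx s - diag_mx s
    + diag_mx s *m V^T *m invmx X *m V *m diag_mx s.
  rewrite Zt mulmxBl mulmxKV // mulmxBl !mulmxBr !mulmxA.
  rewrite (mulmxK uX) WV mul1mx -(mulmxA _ V^T W^T) VtWt mulmx1.
  by rewrite opprB addrA addrAC.
rewrite /f /A /B !mxtraceD !raddfN /=.
have -> : \tr (W^T *m W *m X) = \tr (W *m X *m W^T).
  by rewrite -mulmxA mxtrace_mulC.
(* Three cyclic rotations carry [invmx X], [V] and one [diag_mx s] in turn from the front to the
   back. *)
have -> : \tr (invmx X *m (V *m diag_mx s *m diag_mx s *m V^T))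
    = \tr (diag_mx s *m V^T *m invmx X *m V *m diag_mx s).
  by do 3!rewrite -!mulmxA mxtrace_mulC; rewrite -!mulmxA.
ring.
Qed.

Lemma objective_ge (X : 'M[R]_n) :
  sym_posdef X -> (\tr (diag_mx s)) *+ 2 <= f X.
Proof. by move=> posX; rewrite objective_square // lerDl mxtrace_quad_ge0. Qed.

Lemma objective_le_eq (X : 'M[R]_n) :
  sym_posdef X -> f X <= (\tr (diag_mx s)) *+ 2 -> X = V *m diag_mx s *m V^T.
Proof.
move=> posX; rewrite objective_square // gerDl => Z_le0.
have /(mxtrace_quad_eq0 posX)/eqP :
    \tr ((W^T - invmx X *m V *m diag_mx s)^T *m X
         *m (W^T - invmx X *m V *m diag_mx s)) = 0.
  by apply/eqP; rewrite eq_le Z_le0 mxtrace_quad_ge0.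
(* [Z = 0] reads [W^T = invmx X *m V *m diag_mx s]. Multiplying by [X] on the left and by [V^T] on
   the right isolates [X], because [W^T *m V^T = 1%:M]. *)
rewrite subr_eq0 => /eqP/(congr1 (fun M => X *m M *m V^T)).
by rewrite -mulmxA WtVt mulmx1 !mulmxA mulmxV ?sym_posdef_unitmx // mul1mx.
Qed.

Lemma sym_posdef_congr_diag (d : 'rV[R]_n) :
  (forall i, 0 < d 0 i) -> sym_posdef (V *m diag_mx d *m V^T).
Proof.
move=> d_gt0; split; first by rewrite !trmx_mul trmxK tr_diag_mx mulmxA.
move=> v v_neq0; set w := V^T *m v.
have -> : v^T *m (V *m diag_mx d *m V^T) *m v = w^T *m diag_mx d *m w.
  by rewrite /w trmx_mul trmxK !mulmxA.
have wE : (w^T *m diag_mx d *m w) 0 0 = \sum_i d 0 i * (w i 0) ^+ 2.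
  rewrite mxE; apply: eq_bigr => i _; rewrite mul_mx_diag !mxE.
  by rewrite mulrC mulrA -expr2 mulrC.
have term_ge0 i : 0 <= d 0 i * (w i 0) ^+ 2.
  by rewrite mulr_ge0 ?sqr_ge0 // ltW.
rewrite wE lt_def sumr_ge0 // andbT psumr_eq0 //.
apply/negP => /allP w0; case/eqP: v_neq0.
suff w_eq0 : w = 0 by rewrite -[v]mul1mx -WtVt -mulmxA -/w w_eq0 mulmx0.
apply/colP => i; rewrite [RHS]mxE.
have := w0 i (mem_index_enum _).
by rewrite implyTb mulf_eq0 (gt_eqF (d_gt0 i)) sqrf_eq0 => /eqP.
Qed.

(** The inverse of [V *m diag_mx d *m V^T] is [W^T *m diag_mx d' *m W] with [d'] the entrywise
    inverse of [d], so [V] and [W] cancel under both traces. *)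
Lemma objective_congr_diag (d : 'rV[R]_n) : (forall i, 0 < d 0 i) ->
  f (V *m diag_mx d *m V^T) = \sum_i (d 0 i + (s 0 i) ^+ 2 / d 0 i).
Proof.
move=> d_gt0; pose d' : 'rV[R]_n := \row_i (d 0 i)^-1.
have dd' : diag_mx d *m diag_mx d' = 1%:M.
  rewrite mulmx_diag -diag_const_mx; congr diag_mx.
  by apply/rowP => i; rewrite !mxE divff // gt_eqF.
have invE : invmx (V *m diag_mx d *m V^T) = W^T *m diag_mx d' *m W.
  have uX := sym_posdef_unitmx (sym_posdef_congr_diag d_gt0).
  rewrite -[LHS]mulmx1 -[RHS](mulKmx uX); congr (_ *m _).
  rewrite !mulmxA -(mulmxA _ V^T) VtWt mulmx1 -(mulmxA V) dd' mulmx1.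
  by rewrite VW.
rewrite /f invE /A /B mxtraceD.
have -> : \tr (W^T *m W *m (V *m diag_mx d *m V^T)) = \tr (diag_mx d).
  by rewrite -!mulmxA (mulmxA W V) WV mul1mx mxtrace_mulC -mulmxA VtWt mulmx1.
have -> : \tr (W^T *m diag_mx d' *m W *m (V *m diag_mx s *m diag_mx s *m V^T))
    = \tr (diag_mx d' *m (diag_mx s *m diag_mx s)).
  by rewrite -!mulmxA (mulmxA W V) WV mul1mx mxtrace_mulC -!mulmxA VtWt mulmx1.
rewrite !mulmx_diag !mxtrace_diag -big_split /=; apply: eq_bigr => i _.
by rewrite !mxE expr2 mulrC.
Qed.

Lemma objective_shift_le (e : R) : 0 < e -> (forall i, 0 <= s 0 i) ->
  f (V *m diag_mx (s + const_mx e) *m V^T)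
    <= (\tr (diag_mx s)) *+ 2 + n%:R * e.
Proof.
move=> e_gt0 s_ge0; rewrite objective_congr_diag; last first.
  by move=> i; rewrite !mxE ltr_wpDl.
rewrite mxtrace_diag.
have -> : n%:R * e = \sum_(i < n) e by rewrite sumr_const card_ord mulr_natl.
rewrite -sumrMnl -big_split /=; apply: ler_sum => i _; rewrite !mxE.
have se_gt0 : 0 < s 0 i + e by rewrite ltr_wpDl.
rewrite [leRHS](_ : _ = s 0 i + e + s 0 i); last by ring.
(* What remains is [s_i^2 / (s_i + e) <= s_i], that is [s_i * s_i <= s_i * (s_i + e)]. *)
by rewrite lerD2l ler_pdivrMr // expr2 ler_wpM2l // lerDl ltW.
Qed.

End CompletedSquare.

Lemma unitmx_diag_neq0 (F : fieldType) (n : nat) (d : 'rV[F]_n) i :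
  diag_mx d \in unitmx -> d 0 i != 0.
Proof.
rewrite unitmxE det_diag unitfE; apply: contraNneq => di0.
by rewrite (bigD1 i) //= di0 mul0r.
Qed.

(* The minimum over the (open) positive definite cone is attained only if T has
   full column rank: for m = n = 1, D = 1, T = 0 one minimizes x over x > 0.
   The attainment half of the conclusion is therefore stated under that
   condition; the uniqueness half needs no condition on T. *)
Theorem theorem3p3 (R : realType) (m n : nat) (hmn : (n <= m)%N)
    (D T : 'M[R]_(m, n)) (hD : \rank D = n)
    (A B : 'M[R]_n) (hA : A = D^T *m D) (hB : B = T^T *m T)
    (U S : 'M[R]_n) (hUS : spectral_decomposition A U S)
    (Q : 'M[R]_n) (hQ : Q = S *m U^T *m B *m U *m S)
    (Ubar Sbar : 'M[R]_n) (hUSbar : spectral_decomposition Q Ubar Sbar)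
    (f : 'M[R]_n -> R) (hf : forall X, f X = \tr (A *m X + invmx X *m B))
    (Xstar : 'M[R]_n)
    (hXstar : Xstar = U *m invmx S *m Ubar *m Sbar *m Ubar^T *m invmx S *m U^T) :
  (\rank T = n -> minimizer (@sym_posdef R n) f Xstar) /\
  (forall X : 'M[R]_n, minimizer (@sym_posdef R n) f X -> X = Xstar).
Proof.
have sqrE (K : 'M[R]_n) : K ^+ 2 = K *m K by [].
case: hUS; rewrite sqrE !mulmxA => AE [UtU UUt] _ /diag_mxP[d SE] _.
case: hUSbar; rewrite sqrE !mulmxA.
move=> QE [UbtUb UbUbt] _ /diag_mxP[s SbarE] Sb_ge0.
have s_ge0 i : 0 <= s 0 i by have := Sb_ge0 i; rewrite SbarE mxE eqxx.
have St : S^T = S by rewrite SE tr_diag_mx.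
have uA : A \in unitmx by rewrite hA unitmx_gram.
have uS : S \in unitmx.
  by move: uA; rewrite AE !unitmx_mul => /andP[/andP[_ ->] _].
have SiSt : (invmx S)^T = invmx S by rewrite trmx_inv St.
(* [V] diagonalizes both forms at once: [invmx S] normalizes [A] to the identity, and the rotation
   [Ubar] then diagonalizes what [B] has become. [W] is its inverse. *)
pose V := U *m invmx S *m Ubar; pose W := Ubar^T *m S *m U^T.
have WV : W *m V = 1%:M.
  by rewrite /W /V -!mulmxA (mulmxA U^T) UtU mul1mx mulKVmx.
have Vt : V^T = Ubar^T *m invmx S *m U^T.
  by rewrite /V !trmx_mul SiSt mulmxA.
have XstarE : Xstar = V *m diag_mx s *m V^T.
  by rewrite hXstar Vt -SbarE /V !mulmxA.
have AW : A = W^T *m W.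
  rewrite /W !trmx_mul !trmxK St -!mulmxA (mulmxA Ubar) UbUbt mul1mx AE.
  by rewrite !mulmxA.
have BV : B = V *m diag_mx s *m diag_mx s *m V^T.
  have QsE : Q = Ubar *m diag_mx s *m diag_mx s *m Ubar^T. by rewrite QE SbarE.
  have -> : V *m diag_mx s *m diag_mx s *m V^T
      = U *m invmx S *m Q *m invmx S *m U^T.
    by rewrite QsE Vt /V !mulmxA.
  rewrite hQ !mulmxA mulmxKV // mulmxK //.
  by rewrite UUt mul1mx -mulmxA UUt mulmx1.
have fE X : f X = \tr (W^T *m W *m X
    + invmx X *m (V *m diag_mx s *m diag_mx s *m V^T)) by rewrite hf AW -BV.
split=> [rkT | X [posX minX]].
  have uB : B \in unitmx by rewrite hB unitmx_gram.
  (* [diag_mx s] is a factor of the invertible matrix [B], so none of its diagonal entries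
     vanishes. *)
  have s_gt0 i : 0 < s 0 i.
    rewrite lt_def s_ge0 andbT unitmx_diag_neq0 //.
    by move: uB; rewrite BV !unitmx_mul => /andP[/andP[/andP[_ ->] _] _].
  split=> [|Y posY].
    by rewrite XstarE; exact: sym_posdef_congr_diag WV _ _.
  rewrite XstarE [f (_ *m _)]fE (objective_congr_diag s WV) //.
  rewrite [f Y]fE (le_trans _ (objective_ge _ WV posY)) //.
  (* At [d = s] each summand [s_i + s_i^2 / s_i] equals [2 s_i]. *)
  rewrite mxtrace_diag -sumrMnl ler_sum // => i _.
  by rewrite expr2 mulfK ?gt_eqF // mulr2n.
rewrite XstarE; apply: (objective_le_eq WV posX); rewrite -fE.
apply/ler_addgt0Pr => e e_gt0.
(* A shift by [e / (n + 1)] raises the bound by [n * e / (n + 1) <= e]; the denominator [n + 1] also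
   covers [n = 0]. *)
have d_gt0 : 0 < e / n.+1%:R by rewrite divr_gt0.
have posXd : sym_posdef (V *m diag_mx (s + const_mx (e / n.+1%:R)) *m V^T).
  by apply: (sym_posdef_congr_diag WV) => i; rewrite 2!mxE ltr_wpDl.
apply: le_trans (minX _ posXd) _.
rewrite fE; apply: le_trans (objective_shift_le WV d_gt0 s_ge0) _.
by rewrite lerD2l mulrCA ger_pMr // ler_pdivrMr // mul1r ler_nat.
Qed.
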